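(* Let $\mathcal{G}$ be a dipath space, let $A,B\subseteq V(\mathcal{G})$ and let $k$ be a natural number. Then either there exists a set $X\subseteq V(\mathcal{G})$ with $|X|<k$ meeting every $A$–$B$-path in $\mathcal{G}$, or there exists a set of $k$ pairwise disjoint $A$–$B$-paths in $\mathcal{G}$.
   Context: A subset $Y$ of a linearly ordered set $X$ is called complete (in $X$) if every nonempty $Z \subseteq Y$ has a supremum and an infimum in $X$ and both lie in $Y$. A path is a linearly ordered set $(P,\le_P)$ that is complete in itself. Distinct paths may share elements; intersections and unions of paths refer to their underlying sets; paths are disjoint if their underlying sets are disjoint. A set of paths is compatible if for any two paths $P,Q$ in it, $P\cap Q$ is complete in $P$ (with the order of $P$). For $x \le y$ in a path $P$, the segment of $P$ from $x$ to $y$ is the interval $[x,y]$ of $P$ with the induced order. A path $P$ connects to a path $Q$ if $P \cap Q=\{x\}$ where $x=\max P=\min Q$; in this case the concatenation of $P$ and $Q$ is $P\cup Q$ with the order extending both orders in which every element of $P$ precedes every element of $Q$. A dipath space is a compatible set of paths closed under segments and under concatenations (whenever $P,Q$ are members and $P$ connects to $Q$, their concatenation is a member). $V(\mathcal{G})$ is the union of the underlying sets of the paths of $\mathcal{G}$. An $A$–$B$-path in $\mathcal{G}$ is a path $R\in\mathcal{G}$ with $R\cap A=\{\min R\}$ and $R\cap B=\{\max R\}$. A set meets a path if it intersects its underlying set. *)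

(* Defs.v *)
From Stdlib Require Import List.

Set Implicit Arguments.

Section Dipaths.
Variable V : Type.

(* A candidate path: an underlying set together with a relation (the order).
   Paths are members of this type; distinct paths may share elements. *)
Record dpath := DPath { pset : V -> Prop; pord : V -> V -> Prop }.

Definition linear_order_on (S : V -> Prop) (le : V -> V -> Prop) : Prop :=
  (forall a b, le a b -> S a /\ S b) /\
  (forall a, S a -> le a a) /\
  (forall a b, le a b -> le b a -> a = b) /\
  (forall a b c, le a b -> le b c -> le a c) /\
  (forall a b, S a -> S b -> le a b \/ le b a).

Definition is_sup (X : V -> Prop) (le : V -> V -> Prop) (Z : V -> Prop) (s : V) :=
  X s /\ (forall z, Z z -> le z s) /\
  (forall u, X u -> (forall z, Z z -> le z u) -> le s u).
Definition is_inf (X : V -> Prop) (le : V -> V -> Prop) (Z : V -> Prop) (s : V) :=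
  X s /\ (forall z, Z z -> le s z) /\
  (forall u, X u -> (forall z, Z z -> le u z) -> le u s).

Definition complete_in (X : V -> Prop) (le : V -> V -> Prop) (Y : V -> Prop) :=
  forall Z : V -> Prop, (forall z, Z z -> Y z) -> (exists z, Z z) ->
    (exists s, is_sup X le Z s /\ Y s) /\ (exists i, is_inf X le Z i /\ Y i).

Definition is_path (P : dpath) : Prop :=
  linear_order_on (pset P) (pord P) /\ complete_in (pset P) (pord P) (pset P).

Definition is_min (P : dpath) (m : V) := pset P m /\ forall x, pset P x -> pord P m x.
Definition is_max (P : dpath) (m : V) := pset P m /\ forall x, pset P x -> pord P x m.

Definition segment (P : dpath) (x y : V) : dpath :=
  let S := fun z => pset P z /\ pord P x z /\ pord P z y in
  DPath S (fun a b => S a /\ S b /\ pord P a b).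

Definition connects (P Q : dpath) : Prop :=
  exists x, (forall z, (pset P z /\ pset Q z) <-> z = x) /\ is_max P x /\ is_min Q x.

Definition concat (P Q : dpath) : dpath :=
  DPath (fun z => pset P z \/ pset Q z)
        (fun a b => pord P a b \/ pord Q a b \/ (pset P a /\ pset Q b)).

Definition compatible (G : dpath -> Prop) : Prop :=
  forall P Q, G P -> G Q -> complete_in (pset P) (pord P) (fun z => pset P z /\ pset Q z).

Definition dipath_space (G : dpath -> Prop) : Prop :=
  (forall P, G P -> is_path P) /\
  compatible G /\
  (forall P x y, G P -> pset P x -> pset P y -> pord P x y -> G (segment P x y)) /\
  (forall P Q, G P -> G Q -> connects P Q -> G (concat P Q)).

Definition vertices (G : dpath -> Prop) (x : V) : Prop := exists P, G P /\ pset P x.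

Definition AB_path (G : dpath -> Prop) (A B : V -> Prop) (R : dpath) : Prop :=
  G R /\
  (exists m, is_min R m /\ forall z, (pset R z /\ A z) <-> z = m) /\
  (exists m, is_max R m /\ forall z, (pset R z /\ B z) <-> z = m).

Definition meets (X : V -> Prop) (R : dpath) : Prop := exists x, X x /\ pset R x.

Definition card_lt (X : V -> Prop) (k : nat) : Prop :=
  exists l : list V, length l < k /\ forall x, X x -> In x l.

End Dipaths.

(* Main.v *)
From Stdlib Require Import List Arith Lia Classical ClassicalEpsilon.
Require Import Defs.

Set Implicit Arguments.
Unset Strict Implicit.

(* Discarding the paths that meet A outside their minimum or B outside their
   maximum leaves a dipath space with the same A-B-paths. In it, fix n disjoint
   A-B-paths. An alternating walk consists of finitely many jumps (paths meeting
   the system only in their end points), separated by steps backwards along the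
   system. If such a walk leads from A to B outside the system, then there are
   n + 1 disjoint A-B-paths: rerouting the system through the first jump of a
   shortest walk leaves a walk with one jump less. Otherwise take on each path of
   the system the infimum of the points from which a walk can be launched that
   reaches B. These n points separate A from B: compatibility gives an A-B-path
   avoiding them a first point beyond the infima and before it a last point below
   them, and the segment in between would be a jump launched below an infimum. *)

Section LinearOrder.
Variables (V : Type) (X : V -> Prop) (le : V -> V -> Prop).

Definition strict (x y : V) : Prop := le x y /\ x <> y.

Definition least (C : V -> Prop) (m : V) : Prop := C m /\ forall u, C u -> le m u.

Hypothesis le_linear : linear_order_on X le.

Lemma lin_dom_l x y : le x y -> X x.
Proof. apply le_linear. Qed.

Lemma lin_dom_r x y : le x y -> X y.
Proof. apply le_linear. Qed.

Lemma lin_refl x : X x -> le x x.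
Proof. apply le_linear. Qed.

Lemma lin_antisym x y : le x y -> le y x -> x = y.
Proof. apply le_linear. Qed.

Lemma lin_trans x y z : le x y -> le y z -> le x z.
Proof. apply le_linear. Qed.

Lemma lin_total x y : X x -> X y -> le x y \/ le y x.
Proof. apply le_linear. Qed.

Lemma strict_not_le x y : strict x y -> ~ le y x.
Proof. intros [xy ne] yx. exact (ne (lin_antisym xy yx)). Qed.

Lemma le_or_strict x y : X x -> X y -> le x y \/ strict y x.
Proof.
  intros Xx Xy. destruct (lin_total Xx Xy) as [xy|yx]; [now left|].
  destruct (classic (y = x)) as [->|ne]; [now left|now right].
Qed.

Lemma is_inf_strict Z x z : is_inf X le Z x -> (forall v, Z v -> X v) ->
  strict x z -> exists v, Z v /\ strict v z.
Proof.
  intros [_ [_ x_glb]] ZX xz. apply NNPP. intros none.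
  assert (Xz : X z) by exact (lin_dom_r (proj1 xz)).
  apply (strict_not_le xz), x_glb; [assumption|]. intros v Zv.
  destruct (le_or_strict Xz (ZX v Zv)) as [zv|vz]; [assumption|].
  exfalso. apply none. now exists v.
Qed.

Lemma least_union C D :
  (forall z, C z -> X z) -> (forall z, D z -> X z) ->
  ((exists z, C z) -> exists m, least C m) ->
  ((exists z, D z) -> exists m, least D m) ->
  (exists z, C z \/ D z) -> exists m, least (fun z => C z \/ D z) m.
Proof.
  intros CX DX leastC leastD nonempty.
  destruct (classic (exists z, C z)) as [exC|noC];
    destruct (classic (exists z, D z)) as [exD|noD].
  - destruct (leastC exC) as [c [Cc c_le]], (leastD exD) as [d [Dd d_le]].
    destruct (lin_total (CX _ Cc) (DX _ Dd)) as [cd|dc].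
    + exists c. split; [now left|]. intros u [Cu|Du]; [auto|].
      exact (lin_trans cd (d_le _ Du)).
    + exists d. split; [now right|]. intros u [Cu|Du]; [|auto].
      exact (lin_trans dc (c_le _ Cu)).
  - destruct (leastC exC) as [c [Cc c_le]]. exists c. split; [now left|].
    intros u [Cu|Du]; [auto|]. exfalso. eauto.
  - destruct (leastD exD) as [d [Dd d_le]]. exists d. split; [now right|].
    intros u [Cu|Du]; [|auto]. exfalso. eauto.
  - exfalso. destruct nonempty as [z [Cz|Dz]]; eauto.
Qed.

Definition bigcup (n : nat) (C : nat -> V -> Prop) (z : V) : Prop :=
  exists i, i < n /\ C i z.

Lemma bigcup_succ n C z : bigcup (S n) C z <-> bigcup n C z \/ C n z.
Proof.
  split.
  - intros [i [Hi Cz]]. destruct (Nat.eq_dec i n) as [->|ne]; [now right|].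
    left. exists i. split; [lia|assumption].
  - intros [[i [Hi Cz]]|Cz]; [exists i|exists n]; (split; [lia|assumption]).
Qed.

Lemma least_bigcup n C :
  (forall i z, C i z -> X z) ->
  (forall i, i < n -> (exists z, C i z) -> exists m, least (C i) m) ->
  (exists z, bigcup n C z) -> exists m, least (bigcup n C) m.
Proof.
  intros CX. induction n as [|n IH]; intros leastC [z Cz].
  - destruct Cz as [i [Hi _]]. lia.
  - destruct (@least_union (bigcup n C) (C n)) as [m [Cm m_le]].
    + intros u [i [_ Cu]]. eauto.
    + eauto.
    + apply IH. auto.
    + auto.
    + exists z. now apply bigcup_succ.
    + exists m. split; [now apply bigcup_succ|].
      intros u Cu. apply m_le. now apply bigcup_succ.
Qed.

End LinearOrder.

Definition greatest {V : Type} (le : V -> V -> Prop) : (V -> Prop) -> V -> Prop :=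
  least (fun x y => le y x).

Lemma linear_order_on_converse {V : Type} (S : V -> Prop) (le : V -> V -> Prop) :
  linear_order_on S le -> linear_order_on S (fun x y => le y x).
Proof.
  intros [dom [refl [antisym [trans total]]]].
  repeat split; eauto; intros; now apply (dom b a).
Qed.

Section Paths.
Variables (V : Type) (P : dpath V).

Lemma le_min_eq m x :
  linear_order_on (pset P) (pord P) -> is_min P m -> pord P x m -> x = m.
Proof.
  intros lin [_ m_le] xm. apply (lin_antisym lin xm), m_le, (lin_dom_l lin xm).
Qed.

Lemma max_le_eq m x :
  linear_order_on (pset P) (pord P) -> is_max P m -> pord P m x -> x = m.
Proof.
  intros lin [_ le_m] mx. apply (lin_antisym lin); [|assumption].
  apply le_m, (lin_dom_r lin mx).
Qed.

Lemma path_min x : is_path P -> pset P x -> exists m, is_min P m.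
Proof.
  intros [_ complete] Px.
  destruct (complete (pset P)) as [_ [m [[Pm [m_le _]] _]]]; [auto|eauto|].
  now exists m.
Qed.

Lemma path_max x : is_path P -> pset P x -> exists m, is_max P m.
Proof.
  intros [_ complete] Px.
  destruct (complete (pset P)) as [[m [[Pm [le_m _]] _]] _]; [auto|eauto|].
  now exists m.
Qed.

(* The infimum of the empty set is the maximum of the path. *)
Lemma path_inf Z x : is_path P -> pset P x -> (forall z, Z z -> pset P z) ->
  exists i, is_inf (pset P) (pord P) Z i.
Proof.
  intros pathP Px ZP. destruct (classic (exists z, Z z)) as [exZ|noZ].
  - destruct pathP as [_ complete].
    destruct (complete Z ZP exZ) as [_ [i [infi _]]]. now exists i.
  - destruct (path_max pathP Px) as [m [Pm le_m]]. exists m.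
    split; [assumption|split; [|auto]]. intros z Zz. exfalso. eauto.
Qed.

Lemma is_min_segment m x y :
  is_min P m -> pset (segment P x y) m -> is_min (segment P x y) m.
Proof.
  intros [_ m_le] Sm. split; [assumption|]. intros u Su.
  repeat split; try apply Sm; try apply Su. apply m_le, Su.
Qed.

Lemma is_max_segment m x y :
  is_max P m -> pset (segment P x y) m -> is_max (segment P x y) m.
Proof.
  intros [_ le_m] Sm. split; [assumption|]. intros u Su.
  repeat split; try apply Sm; try apply Su. apply le_m, Su.
Qed.

Lemma is_min_concat Q m : is_min P m -> is_min (concat P Q) m.
Proof.
  intros [Pm m_le]. split; [now left|].
  intros u [Pu|Qu]; [left; auto|right; right; auto].
Qed.

Lemma is_max_concat Q m : is_max Q m -> is_max (concat P Q) m.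
Proof.
  intros [Qm le_m]. split; [now right|].
  intros u [Pu|Qu]; [right; right; auto|right; left; auto].
Qed.

End Paths.

Definition update {T : Type} (f : nat -> T) (j : nat) (x : T) (i : nat) : T :=
  if Nat.eq_dec i j then x else f i.

Section ABPaths.
Variables (V : Type) (G : dpath V -> Prop) (A B : V -> Prop).

Definition AB_extremal (P : dpath V) : Prop :=
  (forall x, pset P x -> A x -> is_min P x) /\
  (forall x, pset P x -> B x -> is_max P x).

Lemma AB_extremal_segment (P : dpath V) x y :
  AB_extremal P -> AB_extremal (segment P x y).
Proof.
  intros [Amin Bmax]. split; intros z Sz Hz.
  - apply is_min_segment; [apply Amin; [apply Sz|assumption]|assumption].
  - apply is_max_segment; [apply Bmax; [apply Sz|assumption]|assumption].
Qed.

Lemma AB_extremal_concat (P Q : dpath V) :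
  linear_order_on (pset P) (pord P) -> linear_order_on (pset Q) (pord Q) ->
  connects P Q -> AB_extremal P -> AB_extremal Q -> AB_extremal (concat P Q).
Proof.
  intros linP linQ [c [_ [maxc minc]]] [AminP BmaxP] [AminQ BmaxQ].
  split; intros z [Pz|Qz] Hz.
  - apply is_min_concat. auto.
  - assert (z = c) as ->
      by (apply (le_min_eq linQ minc), (AminQ z Qz Hz), minc).
    apply is_min_concat, AminP; [apply maxc|assumption].
  - assert (z = c) as ->
      by (apply (max_le_eq linP maxc), (BmaxP z Pz Hz), maxc).
    apply is_max_concat, BmaxQ; [apply minc|assumption].
  - apply is_max_concat. auto.
Qed.

Definition extremal_paths (P : dpath V) : Prop := G P /\ AB_extremal P.

Lemma extremal_paths_space : dipath_space G -> dipath_space extremal_paths.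
Proof.
  intros [path [compat [seg conc]]]. split; [|split; [|split]].
  - intros P [GP _]. auto.
  - intros P Q [GP _] [GQ _]. auto.
  - intros P x y [GP extP] Px Py xy.
    split; [auto|now apply AB_extremal_segment].
  - intros P Q [GP extP] [GQ extQ] conn. split; [auto|].
    apply AB_extremal_concat; try assumption; now apply path.
Qed.

Lemma AB_path_extremal_paths R :
  AB_path extremal_paths A B R <-> AB_path G A B R.
Proof.
  split; [intros [[GR _] ends]; now split|].
  intros [GR [[a [mina Aa]] [b [maxb Bb]]]].
  split; [split; [assumption|split]|split; [now exists a|now exists b]].
  - intros x Rx Ax. now assert (x = a) as -> by now apply Aa.
  - intros x Rx Bx. now assert (x = b) as -> by now apply Bb.
Qed.

Definition has_separator_lt (k : nat) : Prop :=
  exists X : V -> Prop,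
    (forall x, X x -> vertices G x) /\ card_lt X k /\
    (forall R, AB_path G A B R -> meets X R).

Definition disjoint_system (n : nat) (Ps : nat -> dpath V) : Prop :=
  (forall i, i < n -> AB_path G A B (Ps i)) /\
  (forall i j z, i < n -> j < n -> i <> j ->
     pset (Ps i) z -> pset (Ps j) z -> False).

Lemma disjoint_system_update (n j : nat) (Ps : nat -> dpath V) (Q : dpath V) :
  (forall i, i < n -> i <> j -> AB_path G A B (Ps i)) ->
  (forall i l z, i < n -> l < n -> i <> j -> l <> j -> i <> l ->
     pset (Ps i) z -> pset (Ps l) z -> False) ->
  AB_path G A B Q ->
  (forall i z, i < n -> i <> j -> pset (Ps i) z -> pset Q z -> False) ->
  disjoint_system n (update Ps j Q).
Proof.
  intros AB disj ABQ disjQ. split.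
  - intros i Hi. unfold update. destruct (Nat.eq_dec i j); auto.
  - intros i l z Hi Hl il. unfold update.
    destruct (Nat.eq_dec i j) as [->|ij], (Nat.eq_dec l j) as [->|lj]; eauto.
Qed.

End ABPaths.

Section DipathSpace.
Variables (V : Type) (G : dpath V -> Prop).
Hypothesis Gspace : dipath_space G.

Lemma space_linear P : G P -> linear_order_on (pset P) (pord P).
Proof. intros GP. now apply Gspace. Qed.

Lemma inter_least P Q : G P -> G Q -> (exists z, pset P z /\ pset Q z) ->
  exists m, least (pord P) (fun z => pset P z /\ pset Q z) m.
Proof.
  intros GP GQ nonempty. destruct Gspace as [_ [compat _]].
  destruct (compat P Q GP GQ _ (fun z h => h) nonempty) as [_ [i [[_ [i_le _]] Pi]]].
  now exists i.
Qed.

Lemma inter_greatest P Q : G P -> G Q -> (exists z, pset P z /\ pset Q z) ->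
  exists m, greatest (pord P) (fun z => pset P z /\ pset Q z) m.
Proof.
  intros GP GQ nonempty. destruct Gspace as [_ [compat _]].
  destruct (compat P Q GP GQ _ (fun z h => h) nonempty) as [[s [[_ [le_s _]] Ps]] _].
  now exists s.
Qed.

Definition link (P : dpath V) (x y : V) : Prop := G P /\ is_min P x /\ is_max P y.

Lemma segment_link P x y : G P -> pord P x y -> link (segment P x y) x y.
Proof.
  intros GP xy. pose proof (space_linear GP) as lin.
  pose proof (lin_dom_l lin xy) as Px. pose proof (lin_dom_r lin xy) as Py.
  pose proof (lin_refl lin Px). pose proof (lin_refl lin Py).
  split; [now apply Gspace|].
  split; split; simpl; try tauto; intros z [Pz [xz zy]]; tauto.
Qed.

Lemma concat_link P Q x y z : link P x y -> link Q y z ->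
  (forall u, pset P u -> pset Q u -> u = y) -> link (concat P Q) x z.
Proof.
  intros [GP [minx maxy]] [GQ [miny maxz]] inter. split.
  - apply Gspace; [assumption..|]. exists y. split; [|now split].
    intros u. split; [intros []; auto|intros ->]. split; [apply maxy|apply miny].
  - split; [now apply is_min_concat|now apply is_max_concat].
Qed.

(* Follow [P] up to its first point on [Q], and [Q] from there on. *)
Lemma splice_link P Q x y s z t : link P x y -> link Q s z -> pset P t -> pset Q t ->
  exists c K, pset P c /\ pset Q c /\ pord P c t /\ link K x z /\
    forall u, pset K u -> pord P u c \/ pord Q c u.
Proof.
  intros [GP [[_ x_le] _]] [GQ [_ [_ le_z]]] Pt Qt.
  destruct (inter_least GP GQ) as [c [[Pc Qc] c_le]]; [now exists t|].
  exists c, (concat (segment P x c) (segment Q c z)).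
  split; [assumption|]. split; [assumption|]. split; [now apply c_le|]. split.
  - apply concat_link with c; [apply segment_link; auto..|].
    intros u [Pu [_ uc]] [Qu _]. apply (lin_antisym (space_linear GP) uc).
    now apply c_le.
  - intros u [[_ [_ uc]]|[_ [cu _]]]; [now left|now right].
Qed.

Lemma inter_above_least R P x : G R -> G P ->
  (exists z, pset R z /\ pord P x z) ->
  exists m, least (pord R) (fun z => pset R z /\ pord P x z) m.
Proof.
  intros GR GP [z [Rz xz]]. pose proof (space_linear GP) as linP.
  destruct (path_max (proj1 Gspace P GP) (lin_dom_r linP xz)) as [b [Pb le_b]].
  assert (above : forall u, pord P x u -> pset (segment P x b) u).
  { intros u xu. pose proof (lin_dom_r linP xu). repeat split; auto. }
  assert (xb : pord P x b) by (apply le_b, (lin_dom_l linP xz)).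
  destruct (inter_least GR (proj1 (segment_link GP xb)))
    as [m [[Rm [_ [xm _]]] m_le]]; [now exists z; auto|].
  exists m. split; [now split|]. intros u [Ru xu]. auto.
Qed.

Lemma inter_below_greatest R P x : G R -> G P ->
  (exists z, pset R z /\ pord P z x) ->
  exists m, greatest (pord R) (fun z => pset R z /\ pord P z x) m.
Proof.
  intros GR GP [z [Rz zx]]. pose proof (space_linear GP) as linP.
  destruct (path_min (proj1 Gspace P GP) (lin_dom_l linP zx)) as [a [Pa a_le]].
  assert (below : forall u, pord P u x -> pset (segment P a x) u).
  { intros u ux. pose proof (lin_dom_l linP ux). repeat split; auto. }
  assert (ax : pord P a x) by (apply a_le, (lin_dom_r linP zx)).
  destruct (inter_greatest GR (proj1 (segment_link GP ax)))
    as [m [[Rm [_ [_ mx]]] le_m]]; [now exists z; auto|].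
  exists m. split; [now split|]. intros u [Ru ux]. apply le_m. auto.
Qed.

Variables A B : V -> Prop.
Hypothesis Gextremal : forall P, G P -> AB_extremal A B P.

Lemma link_A_start P x y z : link P x y -> pset P z -> A z -> z = x.
Proof.
  intros [GP [minx _]] Pz Az. apply (le_min_eq (space_linear GP) minx).
  apply (proj1 (Gextremal GP) z Pz Az), minx.
Qed.

Lemma link_B_end P x y z : link P x y -> pset P z -> B z -> z = y.
Proof.
  intros [GP [_ maxy]] Pz Bz. apply (max_le_eq (space_linear GP) maxy).
  apply (proj2 (Gextremal GP) z Pz Bz), maxy.
Qed.

Lemma AB_path_link R : AB_path G A B R <-> exists a b, link R a b /\ A a /\ B b.
Proof.
  split.
  - intros [GR [[a [mina Aa]] [b [maxb Bb]]]]. exists a, b.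
    split; [now split|]. split; [now apply Aa|now apply Bb].
  - intros [a [b [Rab [Aa Bb]]]]. pose proof Rab as [GR [mina maxb]].
    split; [assumption|]. split; [exists a|exists b]; (split; [assumption|]);
      intros z; (split; [intros [Rz Hz]|intros ->]).
    + exact (link_A_start Rab Rz Hz).
    + split; [apply mina|assumption].
    + exact (link_B_end Rab Rz Hz).
    + split; [apply maxb|assumption].
Qed.

Section System.
Variable n : nat.

Definition on_system (Ps : nat -> dpath V) : V -> Prop :=
  bigcup n (fun i => pset (Ps i)).

Definition jump (Ps : nat -> dpath V) (J : dpath V) (v w : V) : Prop :=
  link J v w /\ forall z, pset J z -> on_system Ps z -> z = v \/ z = w.

Definition entry (Ps : nat -> dpath V) (J : dpath V) (a w : V) : Prop :=
  link J a w /\ A a /\ forall z, pset J z -> on_system Ps z -> z = w.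

(* [finishable Ps m w]: an alternating walk that has just arrived at [w] can be
   completed to [B] using [m] more jumps, each preceded by a nontrivial step
   backwards along a path of the system. *)
Fixpoint finishable (Ps : nat -> dpath V) (m : nat) (w : V) : Prop :=
  match m with
  | 0 => B w /\ ~ on_system Ps w
  | S m => exists i v J w', i < n /\ strict (pord (Ps i)) v w /\
             jump Ps J v w' /\ finishable Ps m w'
  end.

Definition augmenting (Ps : nat -> dpath V) (m : nat) : Prop :=
  exists J a w, entry Ps J a w /\ finishable Ps m w.

Lemma entry_splice Ps J a w J' v w' x :
  entry Ps J a w -> jump Ps J' v w' -> pset J x -> pset J' x -> ~ on_system Ps x ->
  exists K, entry Ps K a w'.
Proof.
  intros [Jaw [Aa Jsys]] [J'vw' J'sys] Jx J'x off_x.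
  destruct (splice_link Jaw J'vw' Jx J'x) as [c [K [Jc [J'c [cx [Kaw' Kin]]]]]].
  pose proof (space_linear (proj1 Jaw)) as linJ.
  pose proof (space_linear (proj1 J'vw')) as linJ'.
  assert (off_c : ~ on_system Ps c).
  { intros on_c. apply off_x. assert (c = w) as -> by now apply Jsys.
    now rewrite (max_le_eq linJ (proj2 (proj2 Jaw)) cx). }
  exists K. split; [assumption|]. split; [assumption|]. intros z Kz on_z.
  destruct (Kin z Kz) as [zc|cz].
  - exfalso. apply off_c. assert (z = w) as -> by exact (Jsys z (lin_dom_l linJ zc) on_z).
    now rewrite (max_le_eq linJ (proj2 (proj2 Jaw)) zc).
  - destruct (J'sys z (lin_dom_r linJ' cz) on_z) as [->|]; [|assumption].
    exfalso. apply off_c. now rewrite (le_min_eq linJ' (proj1 (proj2 J'vw')) cz).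
Qed.

Section Reroute.
Variables (Ps : nat -> dpath V) (m j : nat) (J : dpath V) (a w b : V).
Hypothesis sys : disjoint_system G A B n Ps.
Hypothesis no_shorter : forall q, q <= m -> ~ augmenting Ps q.
Hypothesis Jentry : entry Ps J a w.
Hypothesis jn : j < n.
Hypothesis Pw : pset (Ps j) w.
Hypothesis maxb : is_max (Ps j) b.

Let linPj : linear_order_on (pset (Ps j)) (pord (Ps j)).
Proof. apply space_linear. now apply sys. Qed.

Definition detour : dpath V := concat J (segment (Ps j) w b).

Definition rerouted : nat -> dpath V := update Ps j detour.

Lemma detour_link : link detour a b.
Proof.
  destruct Jentry as [Jaw [_ Jsys]].
  apply concat_link with w; [assumption| |].
  - apply segment_link; [now apply sys|]. now apply maxb.
  - intros u Ju [Pu _]. apply Jsys; [assumption|]. now exists j.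
Qed.

Lemma rerouted_system : disjoint_system G A B n rerouted.
Proof.
  destruct sys as [AB disj]. apply disjoint_system_update.
  - auto.
  - eauto.
  - apply AB_path_link. exists a, b. split; [exact detour_link|].
    split; [apply Jentry|]. destruct (AB j jn) as [_ [_ [b' [maxb' Bb']]]].
    assert (b = b') as -> by (apply (max_le_eq linPj maxb'), maxb, maxb').
    now apply Bb'.
  - intros i z Hi ij Pz [Jz|[Pjz _]]; [|exact (disj i j z Hi jn ij Pz Pjz)].
    assert (z = w) as -> by (apply Jentry; [assumption|now exists i]).
    exact (disj i j w Hi jn ij Pz Pw).
Qed.

Lemma on_rerouted z : on_system rerouted z ->
  pset J z \/ on_system Ps z /\ (pset (Ps j) z -> pord (Ps j) w z).
Proof.
  intros [i [Hi Hz]]. unfold rerouted, update in Hz.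
  destruct (Nat.eq_dec i j) as [->|ij].
  - destruct Hz as [Jz|[Pz [wz _]]]; [now left|right].
    split; [now exists j|auto].
  - right. split; [now exists i|]. intros Pz. exfalso.
    exact (proj2 sys i j z Hi jn ij Hz Pz).
Qed.

Lemma off_rerouted z : strict (pord (Ps j)) z w -> ~ on_system rerouted z.
Proof.
  intros zw on_z. pose proof (lin_dom_l linPj (proj1 zw)) as Pz.
  destruct (on_rerouted on_z) as [Jz|[_ wz]].
  - apply (proj2 zw), Jentry; [assumption|now exists j].
  - exact (strict_not_le linPj zw (wz Pz)).
Qed.

Lemma pord_rerouted i v u : pord (Ps i) v u ->
  (i = j -> pord (Ps j) w v) -> pord (rerouted i) v u.
Proof.
  intros vu wv. unfold rerouted, update. destruct (Nat.eq_dec i j) as [->|]; [|assumption].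
  specialize (wv eq_refl).
  pose proof (lin_dom_r linPj wv). pose proof (lin_dom_r linPj vu).
  right; left. repeat split; try assumption; try now apply maxb.
  exact (lin_trans linPj wv vu).
Qed.

Lemma jump_inter_entry q J' v w' x : q <= m -> jump Ps J' v w' -> finishable Ps q w' ->
  pset J x -> pset J' x -> x = v.
Proof.
  intros Hq J'jump fin Jx J'x.
  destruct (classic (on_system Ps x)) as [on_x|off_x].
  - destruct (proj2 J'jump x J'x on_x) as [|xw']; [assumption|].
    exfalso. apply (no_shorter Hq). exists J, a, w. split; [assumption|].
    now replace w with w' by (rewrite <- xw'; now apply Jentry).
  - destruct (entry_splice Jentry J'jump Jx J'x off_x) as [K Kentry].
    exfalso. apply (no_shorter Hq). now exists K, a, w'.
Qed.

Lemma jump_rerouted q J' v w' : q <= m -> jump Ps J' v w' -> finishable Ps q w' ->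
  jump rerouted J' v w'.
Proof.
  intros Hq J'jump fin. split; [apply J'jump|]. intros z J'z on_z.
  destruct (on_rerouted on_z) as [Jz|[on_z' _]]; [|now apply J'jump].
  left. exact (jump_inter_entry Hq J'jump fin Jz J'z).
Qed.

Lemma finishable_rerouted q : forall w', q <= m ->
  finishable Ps q w' -> finishable rerouted q w'.
Proof.
  induction q as [|q IH]; intros w' Hq.
  - intros [Bw' off]. split; [assumption|]. intros on.
    destruct (on_rerouted on) as [Jw'|[on' _]]; [|now apply off].
    apply off. rewrite (link_B_end (proj1 Jentry) Jw' Bw'). now exists j.
  - intros [i [v [J' [w'' [Hi [vw' [J'jump fin]]]]]]].
    assert (wv : i = j -> pord (Ps j) w v).
    { intros ->. pose proof (lin_dom_l linPj (proj1 vw')) as Pv.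
      destruct (le_or_strict linPj Pw Pv) as [|vw]; [assumption|].
      exfalso. apply (no_shorter Hq). exists J, a, w. split; [assumption|].
      now exists j, v, J', w''. }
    exists i, v, J', w''. split; [assumption|]. split; [|split].
    + split; [apply pord_rerouted; [apply vw'|assumption]|apply vw'].
    + apply jump_rerouted with q; [lia|assumption..].
    + apply IH; [lia|assumption].
Qed.

Lemma augmenting_rerouted v J' w' : strict (pord (Ps j)) v w ->
  jump Ps J' v w' -> finishable Ps m w' -> augmenting rerouted m.
Proof.
  intros vw J'jump fin.
  pose proof (lin_dom_l linPj (proj1 vw)) as Pv.
  destruct (proj1 (AB_path_link _) (proj1 sys j jn)) as [a' [b' [[GPj [mina' _]] [Aa' _]]]].
  assert (initial : link (segment (Ps j) a' v) a' v)
    by (apply segment_link; [assumption|now apply mina']).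
  assert (start : entry rerouted (segment (Ps j) a' v) a' v).
  { split; [assumption|]. split; [assumption|].
    intros z [_ [_ zv]] on_z. exfalso. apply (@off_rerouted z); [|assumption].
    split; [exact (lin_trans linPj zv (proj1 vw))|].
    intros ->. exact (strict_not_le linPj vw zv). }
  pose proof (jump_rerouted (le_n m) J'jump fin) as J'jump'.
  destruct (entry_splice start J'jump' (proj1 (proj2 (proj2 initial)))) as [K Kentry].
  - apply J'jump.
  - now apply off_rerouted.
  - exists K, a', w'. split; [assumption|]. now apply finishable_rerouted.
Qed.

End Reroute.

Lemma augmenting_zero Ps : disjoint_system G A B n Ps -> augmenting Ps 0 ->
  exists Ps', disjoint_system G A B (S n) Ps'.
Proof.
  intros [AB disj] [J [a [w [[Jaw [Aa Jsys]] [Bw off]]]]].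
  exists (update Ps n J). apply disjoint_system_update.
  - intros i Hi ne. apply AB. lia.
  - intros i l z Hi Hl ne ne'. apply disj; lia.
  - apply AB_path_link. now exists a, w.
  - intros i z Hi ne Pz Jz. apply off.
    assert (on_z : on_system Ps z) by (exists i; split; [lia|assumption]).
    now rewrite <- (Jsys z Jz on_z).
Qed.

Lemma augmenting_system m : forall Ps, disjoint_system G A B n Ps -> augmenting Ps m ->
  exists Ps', disjoint_system G A B (S n) Ps'.
Proof.
  induction m as [m IH] using lt_wf_ind. intros Ps sys aug.
  destruct (classic (exists q, q < m /\ augmenting Ps q)) as [[q [Hq shorter]]|none];
    [exact (IH q Hq Ps sys shorter)|].
  destruct m as [|m]; [exact (augmenting_zero sys aug)|].
  assert (no_shorter : forall q, q <= m -> ~ augmenting Ps q).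
  { intros q Hq shorter. apply none. exists q. split; [lia|assumption]. }
  destruct aug as [J [a [w [Jentry [j [v [J' [w' [jn [vw [J'jump fin]]]]]]]]]]].
  destruct (proj1 sys j jn) as [GPj [_ [b [maxb _]]]].
  pose proof (lin_dom_r (space_linear GPj) (proj1 vw)) as Pw.
  apply (IH m (Nat.lt_succ_diag_r m) (rerouted Ps j J w b)).
  - now apply rerouted_system with a.
  - now apply augmenting_rerouted with a v J' w'.
Qed.

Definition launchable (Ps : nat -> dpath V) (v : V) : Prop :=
  exists m J w, jump Ps J v w /\ finishable Ps m w.

Definition launch_inf (Ps : nat -> dpath V) (i : nat) : V -> Prop :=
  is_inf (pset (Ps i)) (pord (Ps i)) (fun v => pset (Ps i) v /\ launchable Ps v).

Section Separator.
Variables (Ps : nat -> dpath V) (inf : nat -> V).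
Hypothesis sys : disjoint_system G A B n Ps.
Hypothesis no_augmenting : forall m, ~ augmenting Ps m.
Hypothesis infP : forall i, i < n -> launch_inf Ps i (inf i).

Let GPs i : i < n -> G (Ps i).
Proof. intros Hi. now apply sys. Qed.

(* On the way to a point from which [B] can be reached, the last point below the
   infima is itself launchable, so it is one of the infima. *)
Lemma finishable_link_meets_inf R r e m : link R r e -> A r -> finishable Ps m e ->
  (forall i u, i < n -> pset R u -> pset (Ps i) u -> pord (Ps i) u (inf i) \/ u = e) ->
  exists i, i < n /\ pset R (inf i).
Proof.
  intros Rre Ar fin low. pose proof Rre as [GR [_ maxe]].
  pose (below := bigcup n (fun i u => pset R u /\ pord (Ps i) u (inf i))).
  destruct (classic (exists u, below u)) as [ex_below|no_below].
  - pose proof (linear_order_on_converse (space_linear GR)) as geR_linear.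
    assert (last : exists v, greatest (pord R) below v).
    { apply (least_bigcup geR_linear); [tauto| |assumption].
      intros i Hi. now apply inter_below_greatest; [|apply GPs]. }
    destruct last as [v [[j [jn [Rv v_below]]] v_last]].
    pose proof (space_linear (GPs jn)) as linPj.
    assert (v_launch : launchable Ps v).
    { exists m, (segment R v e), e. split; [|assumption].
      split; [apply segment_link; [assumption|now apply maxe]|].
      intros z [Rz [vz _]] [i [Hi Pz]].
      destruct (low i z Hi Rz Pz) as [z_below|]; [left|now right].
      apply (lin_antisym (space_linear GR)); [|assumption].
      apply v_last. now exists i. }
    exists j. split; [assumption|]. replace (inf j) with v; [assumption|].
    apply (lin_antisym linPj v_below), (infP jn).
    split; [exact (lin_dom_l linPj v_below)|assumption].
  - exfalso. apply (@no_augmenting m). exists R, r, e. split; [|assumption].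
    split; [assumption|]. split; [assumption|]. intros z Rz [i [Hi Pz]].
    destruct (low i z Hi Rz Pz) as [z_below|]; [|assumption].
    exfalso. apply no_below. now exists z, i.
Qed.

Lemma AB_link_meets_inf R r s : link R r s -> A r -> B s ->
  exists i, i < n /\ pset R (inf i).
Proof.
  intros Rrs Ar Bs. pose proof Rrs as [GR [minr maxs]].
  pose (above := bigcup n (fun i u => pset R u /\ pord (Ps i) (inf i) u)).
  assert (low : forall i u, i < n -> pset R u -> pset (Ps i) u ->
                  pord (Ps i) u (inf i) \/ above u).
  { intros i u Hi Ru Pu.
    destruct (lin_total (space_linear (GPs Hi)) Pu (proj1 (infP Hi))) as [|u_above];
      [now left|right; now exists i]. }
  destruct (classic (exists u, above u)) as [ex_above|no_above].
  - assert (first : exists e, least (pord R) above e).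
    { apply (least_bigcup (space_linear GR)); [tauto| |assumption].
      intros i Hi. now apply inter_above_least; [|apply GPs]. }
    destruct first as [e [[j [jn [Re e_above]]] e_first]].
    destruct (classic (inf j = e)) as [<-|ne]; [now exists j|].
    assert (inf_lt_e : strict (pord (Ps j)) (inf j) e) by now split.
    destruct (is_inf_strict (space_linear (GPs jn)) (infP jn) (fun _ => @proj1 _ _) inf_lt_e)
      as [v [[_ [m [J [w [Jjump fin]]]]] ve]].
    destruct (@finishable_link_meets_inf (segment R r e) r e (S m)) as [i [Hi [Rf _]]].
    + apply segment_link; [assumption|now apply minr].
    + assumption.
    + now exists j, v, J, w.
    + intros i u Hi [Ru [_ ue]] Pu.
      destruct (low i u Hi Ru Pu) as [|above_u]; [now left|right].
      apply (lin_antisym (space_linear GR) ue). now apply e_first.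
    + now exists i.
  - apply (finishable_link_meets_inf (m := 0) Rrs Ar).
    + split; [assumption|]. intros [i [Hi Pis]]. apply no_above. exists s, i.
      split; [assumption|]. split; [apply maxs|].
      apply (proj2 (Gextremal (GPs Hi)) s Pis Bs), (infP Hi).
    + intros i u Hi Ru Pu. destruct (low i u Hi Ru Pu); [now left|].
      exfalso. apply no_above. now exists u.
Qed.

Lemma has_separator_lt_of_infs : has_separator_lt G A B (S n).
Proof.
  exists (fun x => exists i, i < n /\ x = inf i). split; [|split].
  - intros x [i [Hi ->]]. exists (Ps i). split; [auto|apply (infP Hi)].
  - exists (map inf (seq 0 n)). rewrite length_map, length_seq. split; [lia|].
    intros x [i [Hi ->]]. apply in_map, in_seq. lia.
  - intros R AB. destruct (proj1 (AB_path_link R) AB) as [r [s [Rrs [Ar Bs]]]].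
    destruct (AB_link_meets_inf Rrs Ar Bs) as [i [Hi Rf]].
    exists (inf i). split; [now exists i|assumption].
Qed.

End Separator.

Lemma has_separator_lt_or_larger_system Ps : disjoint_system G A B n Ps ->
  has_separator_lt G A B (S n) \/ exists Ps', disjoint_system G A B (S n) Ps'.
Proof.
  intros sys.
  destruct (classic (exists m, augmenting Ps m)) as [[m aug]|none];
    [right; exact (augmenting_system sys aug)|left].
  destruct (classic (inhabited V)) as [Vinh|Vempty].
  - apply has_separator_lt_of_infs with Ps (fun i => epsilon Vinh (launch_inf Ps i)).
    + assumption.
    + intros m aug. apply none. now exists m.
    + intros i Hi. apply epsilon_spec.
      destruct (proj1 sys i Hi) as [GPi [[a [[Pa _] _]] _]].
      apply path_inf with a; [now apply Gspace|assumption|tauto].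
  - exists (fun _ => False). split; [tauto|]. split.
    + exists nil. split; [simpl; lia|tauto].
    + intros R [_ [[r _] _]]. exfalso. apply Vempty. constructor. exact r.
Qed.

End System.

Lemma has_separator_lt_or_disjoint_system k :
  has_separator_lt G A B k \/ exists Ps, disjoint_system G A B k Ps.
Proof.
  induction k as [|k [[X [XV [[l [Hl Xl]] sep]]]|[Ps sys]]].
  - right. exists (fun _ => DPath (fun _ => False) (fun _ _ => False)).
    split; intros; lia.
  - left. exists X. split; [assumption|]. split; [|assumption].
    exists l. split; [lia|assumption].
  - exact (has_separator_lt_or_larger_system sys).
Qed.

End DipathSpace.

Theorem mainTheorem8 (V : Type) (G : dpath V -> Prop) (A B : V -> Prop) (k : nat) :
  dipath_space G ->
  (forall a, A a -> vertices G a) ->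
  (forall b, B b -> vertices G b) ->
  (exists X : V -> Prop,
      (forall x, X x -> vertices G x) /\ card_lt X k /\
      (forall R, AB_path G A B R -> meets X R))
  \/
  (exists Ps : nat -> dpath V,
      (forall i, i < k -> AB_path G A B (Ps i)) /\
      (forall i j z, i < k -> j < k -> i <> j -> pset (Ps i) z -> pset (Ps j) z -> False)).
Proof.
  intros Gspace _ _.
  destruct (has_separator_lt_or_disjoint_system (extremal_paths_space A B Gspace)) with A B k
    as [[X [XV [Xk sep]]]|[Ps [AB disj]]].
  - intros P [_ extP]. exact extP.
  - left. exists X. split; [|split; [assumption|]].
    + intros x Xx. destruct (XV x Xx) as [P [[GP _] Px]]. now exists P.
    + intros R AB. apply sep. now apply AB_path_extremal_paths.
  - right. exists Ps. split; [|assumption].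
    intros i Hi. apply AB_path_extremal_paths with (1 := AB i Hi).
Qed.
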